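(* Let $q=p^n$, where $p$ is a prime and $n$ is a positive integer, and let $\mathbf{F}_q$ be the finite field with $q$ elements. Let $A$ be a non-singular $d\times d$ matrix over $\mathbf{F}_q$, let $f(t)$ be the characteristic polynomial of $A$, and let $m$ be the multiplicative order of $A$. Then: 1) If $f(t)$ is reducible over $\mathbf{F}_q$, then $m<q^d-1$. 2) $f(t)$ is irreducible over $\mathbf{F}_q$ if and only if (a) $m$ is not divisible by $p$, (b) $d$ equals the multiplicative order of $q \pmod m$, and (c) $\operatorname{rk}(A^l-E)=d$ for every positive integer $l<m$ that divides $m$.
   Context: $E$ denotes the $d\times d$ identity matrix. The multiplicative order of a non-singular square matrix $A$ over $\mathbf{F}_q$ is the least positive integer $l$ with $A^l=E$. For a positive integer $m$ not divisible by $p$, the multiplicative order of $q \pmod m$ is the least positive integer $e$ such that $m$ divides $q^e-1$. *)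

(* Defs.v *)
From mathcomp Require Import all_boot all_algebra.

Set Implicit Arguments.
Unset Strict Implicit.
Unset Printing Implicit Defensive.

Import GRing.Theory.
Local Open Scope ring_scope.

(* m is the least positive natural number satisfying P. *)
Definition least_positive (P : nat -> Prop) (m : nat) : Prop :=
  [/\ (0 < m)%N, P m & forall l : nat, (0 < l)%N -> P l -> (m <= l)%N].

Definition mx_mulorder (R : pzRingType) (d : nat) (A : 'M[R]_d) (m : nat) :
    Prop :=
  least_positive (fun l => A ^+ l = 1%:M) m.

(* The subtraction is truncated but harmless for q > 0, since then 1 <= q ^ e.
   No e satisfies this when q and m are not coprime. *)
Definition mulorder_mod (q m e : nat) : Prop :=
  least_positive (fun k => (m %| q ^ k - 1)%N) e.

Definition reducible_poly (F : fieldType) (f : {poly F}) : Prop :=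
  exists g h : {poly F}, [/\ (1 < size g)%N, (1 < size h)%N & f = g * h].

(* Main.v *)
Require Import Defs.
From mathcomp Require Import all_boot all_algebra.
From mathcomp Require Import all_field.

(* If f = g * h with g, h nonconstant, then g(A) or h(A) is not invertible,
   say g(A); so g is distinct from every residue of 'X^k modulo f, and the m
   powers of A inject into the q^d - 2 polynomials of degree < d other than 0
   and g.
   If f is irreducible, A may be replaced by a root z of f in the field
   K = F(z) with q^d elements: A^l - E is 0 if z^l = 1 and invertible otherwise,
   m divides |K| - 1, and z^(q^k) = z forces the additive q^k-th power map to be
   the identity on K.
   Conversely a root z of an irreducible factor g of f is an eigenvalue of A,
   so condition (c) makes its order exactly m; thus m divides q^(deg g) - 1 and
   (b) gives deg g >= d. *)

Local Open Scope ring_scope.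

Import GRing.Theory.

Lemma exists_irreducible_dvdp {F : finFieldType} {f : {poly F}} :
  (1 < size f)%N -> exists2 g, irreducible_poly g & g %| f.
Proof.
have [n] := ubnP (size f); elim: n f => // n IHn f; rewrite ltnS => fn f1.
have [/irreducibleP irr_f|] := boolP (irreducibleb f); first by exists f.
(* Failure of the boolean test yields a divisor [g] with [1 < size g < size f], to which the
   induction applies. *)
rewrite /irreducibleb f1 /= negb_forall.
case/existsP=> [[g sg]] /=; rewrite negb_imply -ltnNge => /andP[gf g1].
rewrite -Pdiv.Idomain.dvdpE in gf.
have [|//|h irr_h hg] := IHn g.
  by apply: leq_ltn_trans sg (leq_trans _ fn); rewrite prednK // ltnW.
by exists h => //; apply: dvdp_trans hg gf.
Qed.

Lemma finField_adjoin_root {F : finFieldType} {f : {poly F}} :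
  irreducible_poly f ->
  exists {K : finFieldType} {iota : {rmorphism F -> K}} {z : K},
    [/\ #|K| = (#|F| ^ (size f).-1)%N, root (map_poly iota f) z
      & forall y, exists g, y = (map_poly iota g).[z]].
Proof.
move=> irr_f; have [L dimL [z fz genL]] := irredp_FAdjoin irr_f.
pose K : finFieldType := finvect_type L.
exists K, (GRing.in_alg (finvect_type L)), z; split=> //.
  rewrite -dimL -(card_vspacef (Vector.class (finvect_type L))).
  by rewrite card_vspace.
move=> y; have: (y : L) \in <<1; z>>%VS by rewrite genL memvf.
by case/Fadjoin_polyP=> g /polyOver1P[h ->] ->; exists h.
Qed.

(** Up to a scalar, [f] is the minimal polynomial of [z]: a [g] that [f] does not divide is coprime
    to [f], and coprime polynomials share no root in [K]. *)
Lemma dvdp_root {F K : fieldType} {iota : {rmorphism F -> K}}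
    {f : {poly F}} {z : K} (g : {poly F}) :
  irreducible_poly f -> root (map_poly iota f) z ->
  root (map_poly iota g) z = (f %| g).
Proof.
move=> irr_f fz; apply/idP/idP=> [gz|/dvdpP[h ->]]; last first.
  by rewrite rmorphM rootM fz orbT.
apply: contraTT gz; rewrite -irreducible_poly_coprime // => cop.
by apply: (coprimep_root (p := map_poly iota f)); rewrite ?coprimep_map.
Qed.

(** [F[A]] is a field: Cayley-Hamilton kills the multiples of the characteristic polynomial, and a
    Bezout relation evaluated at [A] inverts everything else. *)
Lemma horner_mx_irreducible {F : fieldType} {n : nat} {A : 'M[F]_n.+1}
    (g : {poly F}) :
  irreducible_poly (char_poly A) ->
  if char_poly A %| g then horner_mx A g = 0 else horner_mx A g \in unitmx.
Proof.
move=> irr; case: ifP => [/dvdpP[h ->]|/negbT].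
  by rewrite rmorphM /= Cayley_Hamilton mulr0.
rewrite -irreducible_poly_coprime // => /Bezout_eq1_coprimepP[[u v] /= uv].
have: horner_mx A v *m horner_mx A g = 1%:M.
  have /= := congr1 (horner_mx A) uv.
  by rewrite rmorphD !rmorphM /= Cayley_Hamilton mulr0 add0r rmorph1.
by case/mulmx1_unit.
Qed.

Lemma expf_card_subn1 {K : finFieldType} {z : K} :
  z != 0 -> z ^+ (#|K| - 1) = 1.
Proof.
move=> z_neq0; apply: (mulfI z_neq0); rewrite -exprS mulr1 subn1 prednK.
  exact: expf_card.
exact: ltnW (finNzRing_gt1 K).
Qed.

(** The power map is additive, its exponent being a power of the characteristic, and it fixes both
    [z] and the coefficients from [F]; hence it fixes every polynomial expression in [z]. *)
Lemma expr_card_fixed {F K : finFieldType} {iota : {rmorphism F -> K}}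
    {z : K} {k : nat} :
  (forall y, exists g, y = (map_poly iota g).[z]) ->
  z ^+ (#|F| ^ k) = z -> forall y : K, y ^+ (#|F| ^ k) = y.
Proof.
move=> gen zk y; have [g ->] := gen y; set Q := (#|F| ^ k)%N in zk *.
have Q_gt0 : (0 < Q)%N by rewrite expn_gt0 ltnW ?finNzRing_gt1.
have [p p_pr charF] := finPcharP F.
have Q_nat : [pchar K].-nat Q.
  have charK : p \in [pchar K] by rewrite (fmorph_pchar iota).
  rewrite (eq_pnat _ (pcharf_eq charK)) /Q pnatX.
  by rewrite (card_pprimeChar charF) pnatX pnat_id.
have iotaQ (a : F) : a ^+ Q = a.
  rewrite /Q; elim: k {Q zk Q_gt0 Q_nat} => // k IHk.
  by rewrite expnS exprM expf_card.
rewrite horner_coef (big_morph (fun x : K => x ^+ Q) (id1 := 0) (op1 := +%R)).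
- apply: eq_bigr => i _; rewrite exprMn exprAC zk coef_map.
  by rewrite -rmorphXn /= iotaQ.
- by move=> u v; rewrite exprDn_pchar.
- by rewrite expr0n gtn_eqF.
Qed.

Lemma leq_generator_fixed {F K : finFieldType} {iota : {rmorphism F -> K}}
    {z : K} {k d : nat} :
  (0 < k)%N -> #|K| = (#|F| ^ d)%N ->
  (forall y, exists g, y = (map_poly iota g).[z]) ->
  z ^+ (#|F| ^ k) = z -> (d <= k)%N.
Proof.
move=> k_gt0 cardK gen zk; have fixK := expr_card_fixed gen zk.
have F_gt1 := finNzRing_gt1 F; set Q := (#|F| ^ k)%N in zk fixK.
have Q_gt1 : (1 < Q)%N by rewrite -(expn0 #|F|) ltn_exp2l.
rewrite -(leq_exp2l d k F_gt1) -cardK -/Q cardE.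
(* All elements of [K] are roots of this polynomial of degree [Q], so [#|K| <= Q]. *)
have sP : size ('X^Q - 'X : {poly K}) = Q.+1.
  by rewrite size_polyDl ?size_polyXn // size_polyN size_polyX.
rewrite -ltnS -sP max_poly_roots ?enum_uniq -?size_poly_gt0 ?sP //.
by apply/allP=> y _; rewrite rootE !hornerE fixK subrr.
Qed.

Lemma eigenvector_exp {R : comNzRingType} {d l : nat} {A : 'M[R]_d} {v : 'rV_d}
    {z : R} :
  v *m A = z *: v -> v *m A ^+ l = z ^+ l *: v.
Proof.
move=> Av; elim: l => [|l IHl]; first by rewrite mulmx1 scale1r.
by rewrite !exprS mulmxA Av -scalemxAl IHl scalerA.
Qed.

Lemma mulorder_dvdP {R : pzRingType} {d : nat} {A : 'M[R]_d} {m k : nat} :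
  mx_mulorder A m -> A ^+ k = 1%:M -> (m %| k)%N.
Proof.
case=> m_gt0 Am minm; rewrite (divn_eq k m) exprD mulnC exprM Am.
rewrite expr1n mul1r dvdn_addr ?dvdn_mulr // => Ar.
have [->//|r_gt0] := posnP (k %% m)%N.
by move: (minm _ r_gt0 Ar); rewrite leqNgt ltn_pmod.
Qed.

Lemma mulorder_exp_inj {R : pzRingType} {d : nat} {A : 'M[R]_d} {m : nat} :
  mx_mulorder A m -> injective (fun k : 'I_m => A ^+ k).
Proof.
move=> [m_gt0 Am minm]; suff lt i j: (i < j < m)%N -> A ^+ i <> A ^+ j.
  move=> i j /= Aij; apply/val_inj/eqP; case: ltngtP => // [ij|ji].
    by case: (lt i j); rewrite ?ij ?ltn_ord.
  by case: (lt j i); rewrite ?ji ?ltn_ord.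
move=> /andP[ij jm] Aij.
(* Replacing [A ^+ i] by [A ^+ j] turns this exponent into [m], yet it lies strictly between 0 and
   [m]. *)
have := minm (i + (m - j))%N; rewrite addn_gt0 subn_gt0 jm orbT exprD Aij.
rewrite -exprD subnKC ?(ltnW jm) // => /(_ isT Am).
by apply/negP; rewrite -ltnNge addnBA ?(ltnW jm) // ltn_subLR ?ltn_add2r //;
  apply: leq_trans (ltnW jm) (leq_addl _ _).
Qed.

Lemma mulorder_lt_of_reducible {F : finFieldType} {d : nat} {A : 'M[F]_d.+1}
    {m : nat} :
  A \in unitmx -> mx_mulorder A m -> reducible_poly (char_poly A) ->
  (m < #|F| ^ d.+1 - 1)%N.
Proof.
move=> A_unit m_order red; set f := char_poly A.
have f_neq0 : f != 0 by rewrite -size_poly_gt0 size_char_poly.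
have [u [u_neq0 su uA]] : exists u : {poly F},
    [/\ u != 0, (size u <= d.+1)%N & horner_mx A u \isn't a GRing.unit].
  case: red => g [h [g1 h1 f_gh]].
  have g_neq0 : g != 0 by rewrite -size_poly_gt0 ltnW.
  have h_neq0 : h != 0 by rewrite -size_poly_gt0 ltnW.
  have sgh : (size g + size h = d.+3)%N.
    have := size_mul g_neq0 h_neq0; rewrite -f_gh size_char_poly => ->.
    by rewrite prednK // addn_gt0 ltnW.
  (* If [g] gives a unit, then [g(A) h(A) = f(A) = 0] forces [h(A) = 0], and [h] serves as [u]. *)
  have [gU|gN] := boolP (horner_mx A g \is a GRing.unit).
    exists h; split=> //; first by rewrite -ltnS -ltnS -sgh -add2n leq_add2r.
    have -> : horner_mx A h = 0; last by rewrite unitr0.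
    by apply: (mulrI gU); rewrite mulr0 -rmorphM -f_gh /= Cayley_Hamilton.
  exists g; split=> //.
  by rewrite -ltnS -ltnS -sgh -addn2 leq_add2l.
have Ak k : horner_mx A ('X^k %% f) = A ^+ k.
  have /(congr1 (horner_mx A)) := divp_eq 'X^k f.
  rewrite rmorphD rmorphM /= Cayley_Hamilton mulr0 add0r rmorphXn /=.
  by rewrite horner_mx_X => ->.
have Ak_unit k : horner_mx A ('X^k %% f) \is a GRing.unit.
  by rewrite Ak unitrX.
(* Residues are coded as coefficient rows, which form a finite type with [#|F| ^ d.+1] elements. *)
pose r k : 'rV[F]_d.+1 := poly_rV ('X^k %% f).
have rK k : rVpoly (r k) = 'X^k %% f.
  by rewrite poly_rV_K // -ltnS -(size_char_poly A) ltn_modp.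
have r_inj : injective (fun k : 'I_m => r k).
  move=> i j /(congr1 (horner_mx A \o rVpoly)) /=; rewrite !rK !Ak.
  exact: (mulorder_exp_inj m_order).
have r_unit k : horner_mx A (rVpoly (r k)) \is a GRing.unit by rewrite rK.
pose B : {set 'rV[F]_d.+1} := [set 0; poly_rV u].
have: (#|[set r k | k : 'I_m]| <= #|~: B|)%N.
  apply/subset_leq_card/subsetP=> _ /imsetP[k _ ->]; rewrite !inE.
  apply/norP; split; apply: contraTneq (r_unit k) => ->.
    by rewrite linear0 rmorph0 unitr0.
  by rewrite poly_rV_K.
rewrite card_imset // card_ord cardsCs setCK card_mx mul1n cards2.
have -> : (0 : 'rV[F]_d.+1) != poly_rV u.
  by apply: contraNneq u_neq0 => u0; rewrite -(poly_rV_K su) -u0 linear0.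
(* With truncated subtraction, passing from [m <= x - 2] to [m < x - 1] requires [1 < x]. *)
have q_gt1 : (1 < #|F| ^ d.+1)%N
  by rewrite -(expn0 #|F|) ltn_exp2l ?finNzRing_gt1.
by case: (_ ^ _)%N q_gt1 => [|[|x]] // _; rewrite subn2 subn1.
Qed.

Lemma irreducible_mulorder {F : finFieldType} {d : nat} {A : 'M[F]_d.+1}
    {m : nat} :
  A \in unitmx -> mx_mulorder A m -> irreducible_poly (char_poly A) ->
  mulorder_mod #|F| m d.+1
  /\ forall l, (0 < l < m)%N -> \rank (A ^+ l - 1%:M) = d.+1.
Proof.
move=> A_unit m_order irr; have [m_gt0 Am minm] := m_order.
have hornerA l : horner_mx A ('X^l - 1) = A ^+ l - 1%:M.
  by rewrite rmorphB rmorphXn rmorph1 /= horner_mx_X.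
split; last first.
  move=> l /andP[l_gt0 lm]; have := horner_mx_irreducible ('X^l - 1) irr.
  rewrite hornerA; case: ifP => _ => [/subr0_eq Al|]; last exact: mxrank_unit.
  by have := minm _ l_gt0 Al; rewrite leqNgt lm.
have [K [iota [z [cardK fz gen]]]] := finField_adjoin_root irr.
rewrite size_char_poly /= in cardK.
(* Both sides say that the characteristic polynomial divides ['X^l - 1]. *)
have zA l : z ^+ l = 1 <-> A ^+ l = 1%:M.
  have := horner_mx_irreducible ('X^l - 1) irr; rewrite hornerA.
  rewrite -(dvdp_root _ irr fz) rmorphB rmorphXn /= map_polyX rmorph1.
  rewrite rootE !hornerE subr_eq0; have [->|zl] := eqVneq.
    by move/subr0_eq.
  move=> AU; split=> [zl1|Al1]; first by rewrite zl1 eqxx in zl.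
  by rewrite Al1 subrr unitr0 in AU.
have z_neq0 : z != 0.
  apply: contraTneq m_gt0 => z0; have /eqP := (zA m).2 Am.
  rewrite z0 expr0n; case: m {m_order Am minm} => //= m.
  by rewrite eq_sym oner_eq0.
have subn1K k : ((#|F| ^ k - 1).+1 = #|F| ^ k)%N.
  by rewrite subn1 prednK // expn_gt0 ltnW ?finNzRing_gt1.
split=> [//||k k_gt0 /dvdnP[c mk]].
  by apply: (mulorder_dvdP m_order); apply/zA; rewrite -cardK expf_card_subn1.
apply: leq_generator_fixed k_gt0 cardK gen _.
by rewrite -subn1K mk exprS mulnC exprM ((zA m).2 Am) expr1n mulr1.
Qed.

Lemma irreducible_of_mulorder {F : finFieldType} {d : nat} {A : 'M[F]_d.+1}
    {m : nat} :
  mx_mulorder A m -> mulorder_mod #|F| m d.+1 ->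
  (forall l, (0 < l)%N -> (l < m)%N -> (l %| m)%N ->
     \rank (A ^+ l - 1%:M) = d.+1) ->
  irreducible_poly (char_poly A).
Proof.
move=> [m_gt0 Am minm] [_ _ mind] rk.
have f_neq0 : char_poly A != 0 by rewrite -size_poly_gt0 size_char_poly.
(* Once every irreducible factor has full degree, so has every nonconstant divisor. *)
have irr_size g : irreducible_poly g -> g %| char_poly A -> (d.+2 <= size g)%N.
  move=> irr_g gf.
  have [K [iota [z [cardK gz _]]]] := finField_adjoin_root irr_g.
  have : eigenvalue (map_mx iota A) z.
    rewrite eigenvalue_root_char -map_char_poly.
    by have /dvdpP[h ->] := gf; rewrite rmorphM rootM gz orbT.
  case/eigenvalueP=> v Av v_neq0.
  have vA l : v *m map_mx iota (A ^+ l) = z ^+ l *: v.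
    by rewrite rmorphXn /=; apply: eigenvector_exp.
  have zm : z ^+ m = 1.
    apply/eqP; rewrite -subr_eq0; have := vA m; rewrite Am map_mx1 mulmx1.
    move/esym/eqP; rewrite -subr_eq0 -{2}[v]scale1r -scalerBl scaler_eq0.
    by rewrite (negPf v_neq0) orbF.
  have [l prim_l lm] := prim_order_exists m_gt0 zm.
  have z_neq0 : z != 0.
    by apply: contra_eq_neq zm => ->; rewrite expr0n gtn_eqF // eq_sym oner_eq0.
  (* Otherwise [A ^+ l - 1%:M] has full rank over [F], hence over [K], although it annihilates the
     eigenvector [v]. *)
  have l_eq : l = m.
    move: (dvdn_leq m_gt0 lm); rewrite leq_eqVlt => /predU1P[//|l_lt].
    have rkl := rk l (prim_order_gt0 prim_l) l_lt lm.
    have vAl : v *m map_mx iota (A ^+ l - 1%:M) = 0.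
      rewrite map_mxB mulmxBr vA map_mx1 mulmx1 prim_expr_order //.
      by rewrite scale1r subrr.
    have: row_free (map_mx iota (A ^+ l - 1%:M)).
      by rewrite -row_leq_rank mxrank_map rkl.
    move/row_free_inj/(_ v 0); rewrite vAl mul0mx => /(_ erefl) v0.
    by rewrite v0 eqxx in v_neq0.
  have sg_gt0 : (0 < (size g).-1)%N by case: irr_g; case: (size g) => [|[]].
  rewrite -(ltn_predK irr_g.1) ltnS; apply: mind => //.
  by rewrite -l_eq (prim_order_dvd prim_l) -cardK expf_card_subn1.
split=> [|g g_n1 gf]; first by rewrite size_char_poly.
have g_gt1 : (1 < size g)%N.
  by rewrite ltn_neqAle eq_sym g_n1 size_poly_gt0 (dvdpN0 gf).
have [h irr_h hg] := exists_irreducible_dvdp g_gt1.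
rewrite -dvdp_size_eqp // eqn_leq dvdp_leq //= size_char_poly.
apply: leq_trans (irr_size h irr_h (dvdp_trans hg gf)) (dvdp_leq _ hg).
exact: dvdpN0 gf f_neq0.
Qed.

Theorem theorem2 (p n q : nat) (F : finFieldType) (d : nat) (A : 'M[F]_d)
    (m : nat)
    (p_prime : prime p) (n_gt0 : (0 < n)%N) (q_def : q = (p ^ n)%N)
    (cardF : #|F| = q) (d_gt0 : (0 < d)%N)
    (A_unit : A \in unitmx) (m_order : mx_mulorder A m) :
  (reducible_poly (char_poly A) -> (m < q ^ d - 1)%N) /\
  (irreducible_poly (char_poly A) <->
     [/\ ~~ (p %| m)%N,
         mulorder_mod q m d
       & forall l : nat, (0 < l)%N -> (l < m)%N -> (l %| m)%N ->
           \rank (A ^+ l - 1%:M) = d]).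
Proof.
case: d d_gt0 A A_unit m_order => // d _ A A_unit m_order; rewrite -cardF.
split; first exact: mulorder_lt_of_reducible.
split=> [irr|[_ ord_d rk]]; last exact: irreducible_of_mulorder rk.
have [ord_d rk] := irreducible_mulorder A_unit m_order irr.
split=> // [|l l_gt0 lm _]; last by rewrite rk // l_gt0.
(* If [p] divided [m], it would divide both [q ^ d.+1 - 1] and [q ^ d.+1], hence 1. *)
have [_ m_dvd _] := ord_d; apply: contraTN p_prime => pm.
have: (p %| #|F| ^ d.+1)%N.
  by rewrite cardF q_def -expnM dvdn_exp ?muln_gt0 ?n_gt0.
move: (dvdn_trans pm m_dvd); set Q := (_ ^ _)%N => pQ1 pQ.
have Q_gt0 : (0 < Q)%N by rewrite expn_gt0 ltnW ?finNzRing_gt1.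
by move: pQ; rewrite -(subnK Q_gt0) dvdn_addr // dvdn1 => /eqP->.
Qed.
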